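(* Let $\alpha>0$, let $I\subset\mathbb{R}$ be an interval, and let $a,b,c,A,B,C$ and $u,v$ be real-valued functions on $I$ such that all expressions and derivatives occurring in the identity below (including those in $l[u]$ and $L[v]$) are defined on $I$. If $v(x)$ does not vanish in $I$, then the following identity holds on $I$: $$ \begin{aligned} &\frac{d}{dx}\Big\{\big[u\,(a\varphi(u''))'-a\varphi(u'')u'\big]+\Big[A\varphi(v'')\Big(\frac{u\varphi(u)}{\varphi(v)}\Big)'-\frac{u\varphi(u)}{\varphi(v)}\,(A\varphi(v''))'\Big]-\frac{u}{\varphi(v)}\big[\varphi(v)\,b\varphi(u')-\varphi(u)\,B\varphi(v')\big]\Big\}\\ &=\frac{u}{\varphi(v)}\big\{\varphi(v)\,l[u]-\varphi(u)\,L[v]\big\}+A\,\alpha(\alpha+1)|u|^{\alpha-1}\varphi\Big(\frac{v''}{v}\Big)\Big(\frac{u'v-uv'}{v}\Big)^2\\ &\quad-A\Big[|u''|^{\alpha+1}+\alpha\Big|\frac{u}{v}v''\Big|^{\alpha+1}-(\alpha+1)u''\varphi\Big(\frac{u}{v}v''\Big)\Big]\\ &\quad-B\Big[|u'|^{\alpha+1}+\alpha\Big|\frac{u}{v}v'\Big|^{\alpha+1}-(\alpha+1)u'\varphi\Big(\frac{u}{v}v'\Big)\Big]\\ &\quad+(A-a)|u''|^{\alpha+1}+(B-b)|u'|^{\alpha+1}+(C-c)|u|^{\alpha+1}. \end{aligned} $$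
   Context: For $\alpha>0$, $\varphi(s)=|s|^{\alpha-1}s$ for $s\in\mathbb{R}$, with $\varphi(0)=0$. A prime denotes $d/dx$. The half-linear fourth-order operators are $$l[u]=[a(x)\varphi(u'')]''-[b(x)\varphi(u')]'+c(x)\varphi(u),\qquad L[v]=[A(x)\varphi(v'')]''-[B(x)\varphi(v')]'+C(x)\varphi(v).$$ The requirement that all expressions occurring be defined means in particular that $u,v$ are twice differentiable, that $a\varphi(u'')$ and $A\varphi(v'')$ are twice differentiable, that $b\varphi(u')$ and $B\varphi(v')$ are differentiable, and, when $0<\alpha<1$, that $u$ has no zeros (since $|u|^{\alpha-1}$ is undefined at a zero of $u$). For $\alpha=1$ the factor $|u|^{\alpha-1}$ is identically $1$. *)

(* Defs.v *)
From mathcomp Require Import all_boot all_order all_algebra.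
From mathcomp Require Import all_classical all_reals all_analysis.
Import Order.TTheory GRing.Theory Num.Theory.
Import numFieldNormedType.Exports.

Set Implicit Arguments.
Unset Strict Implicit.
Unset Printing Implicit Defensive.

Local Open Scope classical_set_scope.
Local Open Scope ring_scope.

(* Derivatives relative to a set I: the difference quotient is only taken along
   points of I, so that derivatives at the endpoints of a non-open interval are
   one-sided and values outside I never matter.  The limit filter is proper
   exactly when x is a limit point of I; this holds at every point of an
   interval with more than one point. *)
Definition derivable_on (R : realType) (I : set R) (f : R -> R) (x : R) : Prop :=
  cvg ((f y - f x) / (y - x) @[y --> within I x^']).

Definition derive_on (R : realType) (I : set R) (f : R -> R) (x : R) : R :=
  lim ((f y - f x) / (y - x) @[y --> within I x^']).

Notation "f ^'[ I ]" := (derive_on I f)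
  (at level 8, I at level 200, format "f ^'[ I ]") : ring_scope.

Definition differentiable_on (R : realType) (I : set R) (f : R -> R) : Prop :=
  forall x, I x -> derivable_on I f x.

Definition twice_differentiable_on (R : realType) (I : set R) (f : R -> R) :
    Prop :=
  differentiable_on I f /\ differentiable_on I f^'[I].

(* powR satisfies 0 `^ 0 = 1 and 0 `^ p = 0 for every p != 0, negative p
   included; hence phi alpha 0 = 0 for every alpha, and `|s| `^ (alpha - 1) is
   identically 1 when alpha = 1. *)
Definition phi (R : realType) (alpha s : R) : R := `|s| `^ (alpha - 1) * s.

Definition half_linear_op (R : realType) (alpha : R) (I : set R)
    (a b c u : R -> R) (x : R) : R :=
  (fun y => a y * phi alpha (u^'[I]^'[I] y))^'[I]^'[I] x
  - (fun y => b y * phi alpha (u^'[I] y))^'[I] x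
  + c x * phi alpha (u x).

(* All the expressions in half_linear_op alpha I a b c u are defined on I. *)
Definition half_linear_dom (R : realType) (alpha : R) (I : set R)
    (a b u : R -> R) : Prop :=
  [/\ twice_differentiable_on I u,
      twice_differentiable_on I (fun y => a y * phi alpha (u^'[I]^'[I] y))
    & differentiable_on I (fun y => b y * phi alpha (u^'[I] y))].

(* Main.v *)
Require Import Defs.
From mathcomp Require Import all_boot all_order all_algebra.
From mathcomp Require Import all_classical all_reals all_analysis.
From mathcomp Require Import ring lra.
Import Order.TTheory GRing.Theory Num.Theory.
Import numFieldNormedType.Exports.

Set Implicit Arguments.
Unset Strict Implicit.

Local Open Scope classical_set_scope.
Local Open Scope ring_scope.

(** The quotient w = u phi(u) / phi(v) equals u phi(r) with r = u / v, because
    phi is multiplicative.  Multiplied out, the bracket to be differentiated is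
      u S' - S u' + N w' - w N' - (u b phi(u') - w B phi(v'))
    with S = a phi(u'') and N = A phi(v'').  Only the products S, N, b phi(u')
    and B phi(v') are assumed differentiable, and they only occur as wholes; so
    the product rule applies as soon as w has two derivatives, and the first
    derivatives of S and N cancel in the result.

    The point that needs care is the second derivative of w.  Differentiating
    u phi(r) produces |r|^(alpha - 1), which need not be differentiable at a
    zero of u.  But |r|^(alpha - 1) r = phi(r), so the first derivative can be
    written
      w' = (alpha + 1) phi(r) u' - alpha r phi(r) v',
    in which only phi(r) occurs (has_deriv_on_picone_weight).  As phi is
    differentiable everywhere when alpha >= 1, and away from 0 when alpha < 1
    (is_derive_phi), this form can be differentiated again, at the zeros that u
    may have when alpha >= 1 too (has_deriv_on_picone_weight').  Multiplied by
    A phi(v'') and B phi(v'), these derivatives give the two Picone brackets and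
    the term with the square; what remains is algebra in the values at one point
    (picone_pointwise). *)

(** * Differentiation relative to a set *)

(** Relational, so that the calculus rules compute the derivative and prove its
    existence at once; uniqueness of limits enters only in has_deriv_onE. *)
Definition has_deriv_on (R : realType) (I : set R) (f : R -> R) (x l : R) :
    Prop :=
  (f y - f x) / (y - x) @[y --> within I x^'] --> l.

(** Moving from x towards another point of the interval stays in the interval,
    so every neighbourhood of x meets the interval outside x; limits of
    difference quotients are therefore unique. *)
Lemma within_dnbhs_proper (R : realType) (I : set R) (x : R) :
  is_interval I -> (exists y z : R, [/\ I y, I z & y < z]) -> I x ->
  ProperFilter (within I x^').
Proof.
move=> itvI [y [z [Iy Iz yz]]] Ix; apply: Build_ProperFilter_ex => P /=.
have [t It tx] : exists2 t, I t & t != x.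
  by have [yx|yx] := eqVneq y x; [exists z; rewrite // -yx gt_eqF | exists y].
rewrite /within/= => /nbhs_ballP[e /= e0 eP].
have d0 : 0 < `|t - x| by rewrite normr_gt0 subr_eq0.
(* This step size keeps x + k (t - x) within e / 2 of x and between x and t. *)
pose k := Num.min 1 (e / 2 / `|t - x|).
have k0 : 0 < k by rewrite lt_min ltr01 !divr_gt0.
have k1 : k <= 1 by rewrite ge_min lexx.
exists (x + k * (t - x)); apply: eP => /=.
- rewrite /ball/= opprD addNKr normrN normrM gtr0_norm//.
  rewrite -ltr_pdivlMr// gt_min; apply/orP; right.
  by rewrite ltr_pM2r ?invr_gt0// gtr_pMr// invf_lt1// ltr1n.
- by rewrite -subr_eq0 addrC addKr mulf_neq0 ?subr_eq0// gt_eqF.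
- have [xt|tx'] := leP x t.
    by apply: (itvI x t) => //; apply/andP; split; nra.
  by apply: (itvI t x) => //; apply/andP; split; nra.
Qed.

Lemma derivable_onP (R : realType) (I : set R) (f : R -> R) (x : R) :
  derivable_on I f x -> has_deriv_on I f x (f^'[I] x).
Proof. by []. Qed.

Lemma has_deriv_onE (R : realType) (I : set R) (f : R -> R) (x l : R) :
  ProperFilter (within I x^') -> has_deriv_on I f x l ->
  derivable_on I f x /\ f^'[I] x = l.
Proof.
by move=> PF fl; split; [apply: cvgP fl | apply: cvg_lim fl].
Qed.

Lemma eq_has_deriv_on (R : realType) (I : set R) (f g : R -> R) (x l : R) :
  (forall y, I y -> f y = g y) -> I x ->
  has_deriv_on I f x l -> has_deriv_on I g x l.
Proof.
move=> fg Ix; apply: cvg_trans; apply: near_eq_cvg.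
by near=> y; rewrite !fg//; near: y; apply: withinT.
Unshelve. all: by end_near. Qed.

Lemma has_deriv_on_continuous (R : realType) (I : set R) (f : R -> R)
    (x l : R) :
  has_deriv_on I f x l -> f y @[y --> within I x^'] --> f x.
Proof.
move=> fl.
have idx : (y - x) @[y --> within I x^'] --> (0 : R).
  rewrite -(subrr x); apply: cvgB; last exact: cvg_cst.
  by move=> P xP; apply: cvg_within; apply: cvg_within.
have lim : ((f y - f x) / (y - x) * (y - x) + f x) @[y --> within I x^']
    --> l * 0 + f x.
  by apply: cvgD; [apply: cvgM | exact: cvg_cst].
move: lim; rewrite mulr0 add0r; apply: cvg_trans; apply: near_eq_cvg.
near=> y; rewrite divfK ?subrK// subr_eq0.
by near: y; apply: cvg_within; exact: withinT.
Unshelve. all: by end_near. Qed.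

Lemma has_deriv_onB (R : realType) (I : set R) (f g : R -> R) (x k l : R) :
  has_deriv_on I f x k -> has_deriv_on I g x l ->
  has_deriv_on I (fun y => f y - g y) x (k - l).
Proof.
move=> fk gl; rewrite /has_deriv_on.
under eq_fun do rewrite opprD addrACA -opprD mulrBl.
exact: cvgB.
Qed.

Lemma has_deriv_onD (R : realType) (I : set R) (f g : R -> R) (x k l : R) :
  has_deriv_on I f x k -> has_deriv_on I g x l ->
  has_deriv_on I (fun y => f y + g y) x (k + l).
Proof.
move=> fk gl; rewrite /has_deriv_on.
under eq_fun do rewrite opprD addrACA mulrDl.
exact: cvgD.
Qed.

Lemma has_deriv_on_cst (R : realType) (I : set R) (c x : R) :
  has_deriv_on I (fun=> c) x 0.
Proof.
rewrite /has_deriv_on subrr; under eq_fun do rewrite mul0r; exact: cvg_cst.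
Qed.

Lemma has_deriv_onM (R : realType) (I : set R) (f g : R -> R) (x k l : R) :
  has_deriv_on I f x k -> has_deriv_on I g x l ->
  has_deriv_on I (fun y => f y * g y) x (k * g x + f x * l).
Proof.
move=> fk gl.
have gx := has_deriv_on_continuous gl.
rewrite /has_deriv_on.
have -> : (fun y => (f y * g y - f x * g x) / (y - x)) =
    (fun y => (f y - f x) / (y - x) * g y + f x * ((g y - g x) / (y - x))).
  by apply/funext => y; ring.
by apply: cvgD; apply: cvgM => //; exact: cvg_cst.
Qed.

(** The outer derivative is a full, two-sided one.  Its Caratheodory form
    g z - g (f x) = q z (z - f x) avoids dividing by f y - f x, which may
    vanish at points y arbitrarily close to x. *)
Lemma has_deriv_on_comp (R : realType) (I : set R) (f g : R -> R) (x k l : R) :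
  is_derive (f x) 1 g k -> has_deriv_on I f x l ->
  has_deriv_on I (fun y => g (f y)) x (k * l).
Proof.
move=> /is_derive1_caratheodory[q [gE qc <-]] fl.
have fx := has_deriv_on_continuous fl.
rewrite /has_deriv_on; under eq_fun do rewrite gE -mulrA.
by apply: cvgM => //; exact: (cvg_comp _ _ fx qc).
Qed.

Lemma has_deriv_onV (R : realType) (I : set R) (f : R -> R) (x l : R) :
  f x != 0 -> has_deriv_on I f x l ->
  has_deriv_on I (fun y => (f y)^-1) x (- f x ^- 2 * l).
Proof.
move=> fx0; apply: has_deriv_on_comp.
by have := is_deriveV fx0 (is_derive_id (f x) 1); rewrite /GRing.scale/= mulr1.
Qed.

(** * The power function phi *)

Section phi_theory.
Variables (R : realType) (alpha : R).

Lemma phiM s t : phi alpha (s * t) = phi alpha s * phi alpha t.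
Proof. by rewrite /phi normrM powRM// mulrACA. Qed.

Lemma phi_eq0 s : (phi alpha s == 0) = (s == 0).
Proof.
by rewrite /phi mulf_eq0 powR_eq0 normr_eq0; case: (s == 0); rewrite ?orbT.
Qed.

(** This holds at t = 0 as well, since phi 0 = 0 and division by 0 gives 0. *)
Lemma phi_div s t : phi alpha (s / t) = phi alpha s / phi alpha t.
Proof.
have [->|t0] := eqVneq t 0; first by rewrite invr0 /phi !mulr0 invr0 mulr0.
by apply: (canRL (mulfK _)); rewrite ?phi_eq0// -phiM divfK.
Qed.

Lemma mul_phi s : 0 < alpha -> s * phi alpha s = `|s| `^ (alpha + 1).
Proof.
move=> a0; have [->|s0] := eqVneq s 0.
  by rewrite mul0r normr0 powR0// gt_eqF// addr_gt0.
rewrite (_ : alpha + 1 = (alpha - 1) + 2%:R); last by ring.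
rewrite powRD; last by rewrite normr_eq0 s0 implybT.
by rewrite powR_mulrn// real_normK ?num_real// /phi; ring.
Qed.

(** Away from 0, phi is an ordinary power up to sign.  At 0 the difference
    quotient is |h|^(alpha - 1), which tends to 0 if alpha > 1 and is
    identically 1 if alpha = 1; both agree with the stated value under the
    convention 0^0 = 1. *)
Lemma is_derive_phi (s : R) : 0 < alpha -> (alpha < 1 -> s != 0) ->
  is_derive s 1 (phi alpha) (alpha * `|s| `^ (alpha - 1)).
Proof.
move=> a0 as0.
have pos (t : R) : 0 < t ->
    is_derive t 1 (phi alpha) (alpha * `|t| `^ (alpha - 1)).
  move=> t0; rewrite gtr0_norm//.
  apply: near_eq_is_derive (is_derive1_powR alpha t0).
  near=> y; have y0 : 0 < y by near: y; exact: lt_nbhsr.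
  by rewrite /phi gtr0_norm// mulrC mulr_powRB1// ltW.
have [s0|s0|s0] := ltgtP s 0; last 1 first.
- rewrite s0 in as0 *.
  have [a1|a1] := eqVneq alpha 1.
    have -> : phi alpha = id.
      by apply/funext => t; rewrite /phi a1 subrr powRr0 mul1r.
    by rewrite a1 subrr powRr0 mulr1; exact: is_derive_id.
  have {as0}a1 : 0 < alpha - 1.
    rewrite subr_gt0 lt_neqAle eq_sym a1 leNgt.
    by apply/negP => /as0; rewrite eqxx.
  rewrite normr0 powR0 ?gt_eqF// mulr0.
  have lim0 : h^-1 *: ((phi alpha \o shift 0) (h *: 1) - phi alpha 0)
      @[h --> 0^'] --> (0 : R).
    have n0 : `|h| @[h --> (0 : R)^'] --> (0 : R)^'+.
      move=> P /= [e /= e0 eP]; exists e => //= h he h0; apply: eP => /=.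
        by move: he; rewrite /ball/= !sub0r !normrN normr_id.
      by rewrite normr_gt0.
    apply: cvg_trans; last exact: (cvg_comp _ _ n0 (powR_cvg0 a1)).
    apply: near_eq_cvg; near=> h => /=.
    have h0 : h != 0 by near: h; exact: withinT.
    rewrite addr0 /phi mulr0 subr0 !scaler1 /GRing.scale/=.
    by rewrite mulrCA mulVf ?mulr1.
  by split; [apply: cvgP lim0 | apply: cvg_lim lim0].
- have ns0 : 0 < - s by rewrite oppr_gt0.
  have -> : phi alpha = fun t => - phi alpha (- t).
    by apply/funext => t; rewrite /phi normrN mulrN opprK.
  have := pos _ ns0; rewrite normrN => dns.
  have := is_deriveN (is_derive1_comp dns (is_deriveNid s 1)).
  by rewrite mulrN1 opprK.
- exact: pos.
Unshelve. all: by end_near. Qed.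
End phi_theory.

(** * The quotient u phi(u) / phi(v) and its two derivatives *)

Section Picone_weight.
Variables (R : realType) (alpha : R) (I : set R) (u v : R -> R).
Hypotheses (alpha_gt0 : 0 < alpha)
  (itvI : is_interval I) (I_nondeg : exists x y : R, [/\ I x, I y & x < y])
  (du : twice_differentiable_on I u) (dv : twice_differentiable_on I v)
  (u_neq0 : alpha < 1 -> forall x : R, I x -> u x != 0)
  (v_neq0 : forall x : R, I x -> v x != 0).

Let r x := u x / v x.
Let r' x := u^'[I] x / v x - u x * v^'[I] x / v x ^+ 2.
Let dphir x := alpha * `|r x| `^ (alpha - 1) * r' x.

Definition picone_weight x := u x * phi alpha (u x) / phi alpha (v x).

(** The form of the derivative free of |u / v|^(alpha - 1), hence
    differentiable again. *)
Definition picone_weight' x :=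
  (alpha + 1) * (phi alpha (r x) * u^'[I] x)
  - alpha * (r x * phi alpha (r x) * v^'[I] x).

Lemma has_deriv_on_ratio x : I x -> has_deriv_on I r x (r' x).
Proof.
move=> Ix; have vx0 := v_neq0 Ix.
have := has_deriv_onM (derivable_onP (du.1 _ Ix))
  (has_deriv_onV vx0 (derivable_onP (dv.1 _ Ix))).
by congr has_deriv_on; rewrite /r'; field.
Qed.

Lemma has_deriv_on_phi_ratio x : I x ->
  has_deriv_on I (fun y => phi alpha (r y)) x (dphir x).
Proof.
move=> Ix; apply: has_deriv_on_comp; last exact: has_deriv_on_ratio.
apply: is_derive_phi => // a1.
by rewrite mulf_neq0 ?invr_eq0 ?v_neq0 ?u_neq0.
Qed.

Lemma picone_weightE x : picone_weight x = u x * phi alpha (r x).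
Proof. by rewrite /picone_weight /r phi_div mulrA. Qed.

(** The product rule leaves alpha u |r|^(alpha - 1) r', and writing u = r v
    turns u |r|^(alpha - 1) into phi(r) v. *)
Lemma has_deriv_on_picone_weight x : I x ->
  has_deriv_on I picone_weight x (picone_weight' x).
Proof.
move=> Ix; have vx0 := v_neq0 Ix.
have := has_deriv_onM (derivable_onP (du.1 _ Ix)) (has_deriv_on_phi_ratio Ix).
rewrite -[picone_weight](_ : (fun y => u y * phi alpha (r y)) = _); last first.
  by apply/funext => y; rewrite picone_weightE.
congr has_deriv_on; rewrite /picone_weight' /dphir /r' /phi.
by rewrite /r; field.
Qed.

Lemma derivable_on_picone_weight x : I x ->
  derivable_on I picone_weight x /\ picone_weight^'[I] x = picone_weight' x.
Proof.
move=> Ix; apply: has_deriv_onE; last exact: has_deriv_on_picone_weight.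
exact: within_dnbhs_proper.
Qed.

Definition picone_weight'' x :=
  (alpha + 1) * (phi alpha (r x) * u^'[I]^'[I] x)
  - alpha * (r x * phi alpha (r x) * v^'[I]^'[I] x)
  + alpha * (alpha + 1) * `|r x| `^ (alpha - 1)
    * ((u^'[I] x * v x - u x * v^'[I] x) / v x) ^+ 2 / v x.

Lemma has_deriv_on_picone_weight' x : I x ->
  has_deriv_on I picone_weight' x (picone_weight'' x).
Proof.
move=> Ix; have vx0 := v_neq0 Ix.
have dr := has_deriv_on_ratio Ix; have dp := has_deriv_on_phi_ratio Ix.
have du' := derivable_onP (du.2 _ Ix); have dv' := derivable_onP (dv.2 _ Ix).
have := has_deriv_onB
  (has_deriv_onM (has_deriv_on_cst I (alpha + 1) x) (has_deriv_onM dp du'))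
  (has_deriv_onM (has_deriv_on_cst I alpha x)
    (has_deriv_onM (has_deriv_onM dr dp) dv')).
congr has_deriv_on; rewrite /picone_weight'' /dphir /r' /phi.
by rewrite /r; field.
Qed.
End Picone_weight.

(** * The Picone identity *)

(** The letters stand for the values at one point: u1, u2, v1, v2 for the
    derivatives of u and v; S1, S2, N1, N2 for the derivatives of a phi(u'')
    and A phi(v''); T1, M1 for those of b phi(u') and B phi(v').  The left-hand
    side is what the product rule yields.  Multiplicativity of phi and
    s phi(s) = |s|^(alpha + 1) turn every power into a product of
    |v|^(alpha - 1), |u / v|^(alpha - 1) and values of phi; with these as
    independent variables it is an identity of rational functions. *)
Lemma picone_pointwise (R : realType)
    (alpha u u1 u2 v v1 v2 a b c A B C S1 S2 N1 N2 T1 M1 : R) :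
  0 < alpha -> v != 0 ->
  let phi := phi alpha in
  let r := u / v in
  let w := u * phi u / phi v in
  let w1 := (alpha + 1) * (phi r * u1) - alpha * (r * phi r * v1) in
  let w2 := (alpha + 1) * (phi r * u2) - alpha * (r * phi r * v2)
    + alpha * (alpha + 1) * `|r| `^ (alpha - 1)
      * ((u1 * v - u * v1) / v) ^+ 2 / v in
  (u1 * S1 + u * S2 - (S1 * u1 + a * phi u2 * u2))
  + (N1 * w1 + A * phi v2 * w2 - (w1 * N1 + w * N2))
  - (u1 * (b * phi u1) + u * T1 - (w1 * (B * phi v1) + w * M1)) =
  u / phi v * (phi v * (S2 - T1 + c * phi u) - phi u * (N2 - M1 + C * phi v))
  + A * (alpha * (alpha + 1)) * `|u| `^ (alpha - 1)
    * phi (v2 / v) * ((u1 * v - u * v1) / v) ^+ 2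
  - A * (`|u2| `^ (alpha + 1) + alpha * `|r * v2| `^ (alpha + 1)
         - (alpha + 1) * u2 * phi (r * v2))
  - B * (`|u1| `^ (alpha + 1) + alpha * `|r * v1| `^ (alpha + 1)
         - (alpha + 1) * u1 * phi (r * v1))
  + (A - a) * `|u2| `^ (alpha + 1)
  + (B - b) * `|u1| `^ (alpha + 1)
  + (C - c) * `|u| `^ (alpha + 1).
Proof.
move=> a0 v0 f r w w1 w2.
have urv : u = r * v by rewrite /r divfK.
rewrite /w1 /w2 /w -!mul_phi// {w w1 w2} -/f; clearbody r.
have fM s t : f (s * t) = f s * f t by exact: phiM.
have -> : f (v2 / v) = f v2 / f v by exact: phi_div.
rewrite !fM {}urv !fM normrM powRM//.
have fv : f v = `|v| `^ (alpha - 1) * v by [].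
have fr : f r = `|r| `^ (alpha - 1) * r by [].
have k0 : `|v| `^ (alpha - 1) != 0 by rewrite powR_eq0 normr_eq0 (negbTE v0).
rewrite fv fr.
move: (`|v| `^ (alpha - 1)) (`|r| `^ (alpha - 1)) k0.
move: (f u1) (f u2) (f v1) (f v2) => fu1 fu2 fv1 fv2 kv kr kv0 {fv fr fM f}.
by field; rewrite v0 kv0.
Qed.

Theorem mainTheorem1 (R : realType) (alpha : R) (halpha : 0 < alpha)
    (I : set R) (hI : is_interval I)
    (hI2 : exists x y : R, [/\ I x, I y & x < y])
    (a b c A B C u v : R -> R)
    (hu : half_linear_dom alpha I a b u)
    (hv : half_linear_dom alpha I A B v)
    (hu0 : alpha < 1 -> forall x : R, I x -> u x != 0)
    (hv0 : forall x : R, I x -> v x != 0) :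
  let phi := phi alpha in
  let u' := u^'[I] in
  let u'' := u^'[I]^'[I] in
  let v' := v^'[I] in
  let v'' := v^'[I]^'[I] in
  let l := half_linear_op alpha I a b c in
  let L := half_linear_op alpha I A B C in
  let w := fun x : R => u x * phi (u x) / phi (v x) in
  let F := fun x : R =>
    (u x * (fun y : R => a y * phi (u'' y))^'[I] x - a x * phi (u'' x) * u' x)
    + (A x * phi (v'' x) * w^'[I] x
       - w x * (fun y : R => A y * phi (v'' y))^'[I] x)
    - u x / phi (v x)
      * (phi (v x) * (b x * phi (u' x)) - phi (u x) * (B x * phi (v' x))) in
  differentiable_on I w /\ differentiable_on I F /\
  forall x : R, I x ->
  F^'[I] x =
    u x / phi (v x) * (phi (v x) * l u x - phi (u x) * L v x)
    + A x * (alpha * (alpha + 1)) * `|u x| `^ (alpha - 1)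
      * phi (v'' x / v x) * ((u' x * v x - u x * v' x) / v x) ^+ 2
    - A x * (`|u'' x| `^ (alpha + 1)
             + alpha * `|u x / v x * v'' x| `^ (alpha + 1)
             - (alpha + 1) * u'' x * phi (u x / v x * v'' x))
    - B x * (`|u' x| `^ (alpha + 1)
             + alpha * `|u x / v x * v' x| `^ (alpha + 1)
             - (alpha + 1) * u' x * phi (u x / v x * v' x))
    + (A x - a x) * `|u'' x| `^ (alpha + 1)
    + (B x - b x) * `|u' x| `^ (alpha + 1)
    + (C x - c x) * `|u x| `^ (alpha + 1).
Proof.
move=> phi u' u'' v' v'' l L w F.
have [du dS dT] := hu; have [dv dN dM] := hv.
have w_deriv y : I y ->
    derivable_on I w y /\ w^'[I] y = picone_weight' alpha I u v y.
  exact: derivable_on_picone_weight.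
split; first by move=> x /w_deriv[].
pose S y := a y * phi (u'' y); pose N y := A y * phi (v'' y).
pose T y := b y * phi (u' y); pose M y := B y * phi (v' y).
pose w1 := picone_weight' alpha I u v; pose w2 := picone_weight'' alpha I u v.
(* Multiplying out the last bracket of F and replacing the derivative of w by
   its closed form changes nothing on I. *)
have FE y : I y ->
    u y * S^'[I] y - S y * u' y + (N y * w1 y - w y * N^'[I] y)
    - (u y * T y - w y * M y) = F y.
  move=> Iy; have phiv0 : phi (v y) != 0 by rewrite phi_eq0 hv0.
  have pull s p q X Y : q != 0 ->
      s / q * (q * X - p * Y) = s * X - s * p / q * Y :> R.
    by move=> q0; field.
  by have [_ wE] := w_deriv _ Iy; rewrite /F wE pull.
have dF x : I x -> has_deriv_on I F x
    ((u' x * S^'[I] x + u x * S^'[I]^'[I] x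
      - (S^'[I] x * u' x + S x * u'' x))
     + (N^'[I] x * w1 x + N x * w2 x
        - (w1 x * N^'[I] x + w x * N^'[I]^'[I] x))
     - (u' x * T x + u x * T^'[I] x - (w1 x * M x + w x * M^'[I] x))).
  move=> Ix; apply: (eq_has_deriv_on FE Ix).
  have dux := derivable_onP (du.1 _ Ix).
  have dwx : has_deriv_on I w x (w1 x) by exact: has_deriv_on_picone_weight.
  apply: has_deriv_onB; first apply: has_deriv_onD; apply: has_deriv_onB.
  - exact: has_deriv_onM dux (derivable_onP (dS.2 _ Ix)).
  - apply: has_deriv_onM (derivable_onP (dS.1 _ Ix)) _.
    exact: derivable_onP (du.2 _ Ix).
  - apply: has_deriv_onM (derivable_onP (dN.1 _ Ix)) _.
    exact: has_deriv_on_picone_weight'.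
  - exact: has_deriv_onM dwx (derivable_onP (dN.2 _ Ix)).
  - exact: has_deriv_onM dux (derivable_onP (dT _ Ix)).
  - exact: has_deriv_onM dwx (derivable_onP (dM _ Ix)).
split=> x Ix; have PF := within_dnbhs_proper hI hI2 Ix;
  have [Fd Fx] := has_deriv_onE PF (dF x Ix) => //.
rewrite {}Fx; apply: picone_pointwise => //; exact: hv0.
Qed.
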